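(* Let $I=[t_0,t_1]$ be a compact interval, let $\theta_\star,\theta\in W^{1,\infty}(I;\mathcal P)$, and assume that $\theta$ satisfies $\dot\theta=\kappa_\theta(\theta_\star(t)-\theta(t))$ on $I$ with some $\kappa_\theta>0$. Put $r_\star(t):=\mathcal R_{\mathrm{LA}}(\theta_\star(t))$ and $r_{\mathrm{eff}}(t):=\mathcal R_{\mathrm{LA}}(\theta(t))$. Fix $\sigma\in\{+1,-1\}$ and suppose that: (D1) there exists a unique time $t_\star\in(t_0,t_1)$ such that $$\sigma\bigl(r_\star(t)-1\bigr)<0\quad\text{for }t\in[t_0,t_\star),\qquad r_\star(t_\star)=1;$$ (D2) there exist constants $m_\star>0$ and $\Delta_\star>0$ such that $t_\star+\Delta_\star\le t_1$ and $$\sigma\bigl(r_\star(t)-1\bigr)\ge m_\star(t-t_\star)\qquad\text{for all }t\in[t_\star,t_\star+\Delta_\star];$$ (D3) $\sigma\bigl(r_{\mathrm{eff}}(t)-1\bigr)\le\sigma\bigl(r_\star(t)-1\bigr)$ for all $t\in I$; (D4) there exists $V_\star<\infty$ such that $\|\dot\theta_\star(t)\|\le V_\star$ for a.e. $t\in I$. Define $$E_\star:=\|\theta(t_0)-\theta_\star(t_0)\|+\frac{V_\star}{\kappa_\theta},$$ and assume that $\dfrac{L_{\mathcal R}E_\star}{m_\star}\le\Delta_\star$. Then the effective crossing time $$t_{\mathrm{eff}}^\sigma:=\inf\bigl\{t\in I:\ \sigma\bigl(r_{\mathrm{eff}}(t)-1\bigr)\ge0\bigr\}$$ is well defined and satisfies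 $$0\le t_{\mathrm{eff}}^\sigma-t_\star\le\frac{L_{\mathcal R}E_\star}{m_\star}.$$ In particular, the effective regime cannot cross the threshold value $1$ before the target regime, and it must cross within a delay window of length $L_{\mathcal R}E_\star/m_\star$ after target passage.
   Context: Parameters are $\theta=(\alpha_L,\alpha_R,\gamma_{LR},\gamma_{RL},\mu_L,\mu_R,\delta_L,\delta_R,\eta,\rho)\in\mathcal P$, where $\mathcal P\subset\mathbb R^{10}$ is a compact convex set all of whose points have strictly positive entries. For $\theta\in\mathcal P$, $$K(\theta)=\begin{pmatrix}\alpha_L&\gamma_{RL}\\ \gamma_{LR}&\alpha_R\end{pmatrix},\quad M(\theta)=\begin{pmatrix}\mu_L&0\\0&\mu_R\end{pmatrix},\quad D(\theta)=\begin{pmatrix}\delta_L&0\\0&\delta_R\end{pmatrix},$$ $A^\dagger(\theta)=\frac{\eta}{\eta+\rho}$, $C^\dagger(\theta)=\frac{\rho}{\eta+\rho}$, and $$\mathcal R_{\mathrm{LA}}(\theta)=\lambda_{\mathrm{PF}}\bigl(M(\theta)^{-1}[C^\dagger(\theta)K(\theta)+A^\dagger(\theta)D(\theta)]\bigr),$$ where $\lambda_{\mathrm{PF}}$ is the Perron--Frobenius eigenvalue (spectral radius) of a matrix with strictly positive entries. $L_{\mathcal R}>0$ is a finite constant with $|\mathcal R_{\mathrm{LA}}(\theta_1)-\mathcal R_{\mathrm{LA}}(\theta_2)|\le L_{\mathcal R}\|\theta_1-\theta_2\|$ for all $\theta_1,\theta_2\in\mathcal P$ (such a constant exists). Norms are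 Euclidean. $\theta_\star$ is called the target regime and $\theta$ the effective regime. *)

(* Defs.v *)
From HB Require Import structures.
From mathcomp Require Import all_boot all_order all_algebra.
From mathcomp Require Import all_classical all_reals all_analysis.
From mathcomp Require Import complex.
Import Order.TTheory GRing.Theory Num.Theory.
Import numFieldNormedType.Exports.

Set Implicit Arguments.
Unset Strict Implicit.
Unset Printing Implicit Defensive.

Local Open Scope classical_set_scope.
Local Open Scope ring_scope.

(* Euclidean norm; the library norm `|x| on row vectors is the sup norm. *)
Definition enorm (R : realType) (n : nat) (x : 'rV[R]_n) : R :=
  Num.sqrt (\sum_(i < n) x 0 i ^+ 2).

(* Entries of a parameter vector, in the order
   (alphaL, alphaR, gammaLR, gammaRL, muL, muR, deltaL, deltaR, eta, rho). *)
Section Entries.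
Variables (R : realType) (theta : 'rV[R]_10).

Definition alphaL : R := theta 0 (@Ordinal 10 0 isT).
Definition alphaR : R := theta 0 (@Ordinal 10 1 isT).
Definition gammaLR : R := theta 0 (@Ordinal 10 2 isT).
Definition gammaRL : R := theta 0 (@Ordinal 10 3 isT).
Definition muL : R := theta 0 (@Ordinal 10 4 isT).
Definition muR : R := theta 0 (@Ordinal 10 5 isT).
Definition deltaL : R := theta 0 (@Ordinal 10 6 isT).
Definition deltaR : R := theta 0 (@Ordinal 10 7 isT).
Definition eta : R := theta 0 (@Ordinal 10 8 isT).
Definition rho : R := theta 0 (@Ordinal 10 9 isT).

End Entries.

Definition parameter_set (R : realType) (P : set 'rV[R]_10) : Prop :=
  [/\ compact P, convex_set P &
      forall theta, P theta -> forall i, 0 < theta 0 i].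

Definition mx22 (R : realType) (a b c d : R) : 'M[R]_2 :=
  \matrix_(i < 2, j < 2)
    if i == 0 then (if j == 0 then a else b) else (if j == 0 then c else d).

(* The eigenvalues of a real matrix are taken in the complex numbers R[i]. *)
Definition spectral_radius (R : realType) (n : nat) (A : 'M[R]_n) : R :=
  sup [set ComplexField.Normc.normc z
      | z in [set z : R[i] | eigenvalue (map_mx (real_complex R) A) z]].

Section ThresholdFunctional.
Variables (R : realType) (theta : 'rV[R]_10).

Definition Kmx : 'M[R]_2 :=
  mx22 (alphaL theta) (gammaRL theta) (gammaLR theta) (alphaR theta).
Definition Mmx : 'M[R]_2 := mx22 (muL theta) 0 0 (muR theta).
Definition Dmx : 'M[R]_2 := mx22 (deltaL theta) 0 0 (deltaR theta).
Definition Adag : R := eta theta / (eta theta + rho theta).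
Definition Cdag : R := rho theta / (eta theta + rho theta).

Definition RLA : R :=
  spectral_radius (invmx Mmx *m (Cdag *: Kmx + Adag *: Dmx)).

End ThresholdFunctional.

Section Sobolev.
Variable R : realType.
Local Notation mu := (@lebesgue_measure R).

Definition test_function (t0 t1 : R) (phi : R -> R) : Prop :=
  [/\ forall x, derivable phi x 1,
      continuous (derive1 phi),
      compact (closure [set x | phi x != 0]) &
      closure [set x | phi x != 0] `<=` `]t0, t1[].

Definition Linfty (t0 t1 : R) (f : R -> R) : Prop :=
  f \_ `[t0, t1] \in Lfun mu +oo%E.

(* Test functions are C^1 (rather than C^oo) with compact support in the open
   interval, as in Brezis' one-dimensional definition of W^{1,p}. *)
Definition weak_derivative (t0 t1 : R) (f g : R -> R) : Prop :=
  forall phi, test_function t0 t1 phi ->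
    \int[mu]_(x in `[t0, t1]) (f x * derive1 phi x) =
    - \int[mu]_(x in `[t0, t1]) (g x * phi x).

(* theta belongs to W^{1,oo}([t0, t1]; P), with weak derivative dtheta (which
   is determined up to a null set); theta is the continuous representative, so
   that its pointwise values make sense. *)
Definition W1infty (t0 t1 : R) (n : nat) (P : set 'rV[R]_n)
    (theta dtheta : R -> 'rV[R]_n) : Prop :=
  [/\ {within `[t0, t1], continuous theta},
      forall t, t \in `[t0, t1] -> P (theta t) &
      forall i : 'I_n,
        [/\ Linfty t0 t1 (fun t => theta t 0 i),
            Linfty t0 t1 (fun t => dtheta t 0 i) &
            weak_derivative t0 t1
              (fun t => theta t 0 i) (fun t => dtheta t 0 i)]].

End Sobolev.

(* The times of [t0, t1] at which the signed excess sigma (r - 1) is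
   nonnegative; the crossing time is the infimum of this set. *)
Definition crossing_set (R : realType) (t0 t1 sigma : R) (r : R -> R) : set R :=
  [set t | t0 <= t <= t1 /\ 0 <= sigma * (r t - 1)].

Definition crossing_time (R : realType) (t0 t1 sigma : R) (r : R -> R) : R :=
  inf (crossing_set t0 t1 sigma r).

(* Main.v *)
Require Import Defs.
From mathcomp Require Import all_boot all_order all_algebra.
From mathcomp Require Import all_classical all_reals all_analysis.
From mathcomp Require Import measurable_realfun ess_sup_inf ring lra.
Import Order.TTheory GRing.Theory Num.Theory.
Import numFieldNormedType.Exports.

Local Open Scope classical_set_scope.
Local Open Scope ring_scope.

(** The heart of the matter is the tracking bound
    [enorm (theta t - theta_star t)
       <= enorm (theta t0 - theta_star t0) + V_star / kappa = E_star]
    on the whole interval ([tracking_bound]).  Given it, evaluate at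
    [t' = t_star + LR * E_star / m_star], which lies in the window of [hD2]: the
    signed excess of [r_star] is at least [m_star * (t' - t_star) = LR * E_star]
    there, and by the Lipschitz bound [r_eff] differs from [r_star] by at most
    [LR * E_star], so [t'] belongs to the crossing set.  By [hD1] and [hD3] no
    time before [t_star] belongs to it, so its infimum lies between [t_star] and
    [t'].

    The tracking bound is Gronwall's inequality for functions that are only
    weakly differentiable.  Fix [t], put [v = theta t - theta_star t] and
    [f x = <v, theta x - theta_star x>].  By the relaxation equation and
    Cauchy-Schwarz, the weak derivative of [f] is at most
    [enorm v * V - kappa * f] almost everywhere, and [f t = enorm v ^+ 2].

    To integrate a weak inequality [f' <= C - k * f] ([weak_gronwall]), put
    [F x = (f x - C / k) * expR (k * x)], which formally is nonincreasing.  The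
    nonnegative test functions [expR (k * x) * psi x], where [psi] is a C^1
    plateau with [psi' = hat a d - hat b d], turn the hypothesis into
    [0 <= \int F * (hat a d - hat b d)] ([Rintegral_hat_diff_ge0]): the mean
    value of [F] near [b] does not exceed its mean value near [a].  Since [F] is
    continuous, narrow hats close to the ends of [t0, t] give [F t <= F t0]. *)

(** * Piecewise quadratic steps *)

(** The positive part of [x]. *)
Definition hinge {R : realType} (x : R) : R := Num.max x 0.

Lemma continuous_hinge {R : realType} : continuous (@hinge R).
Proof. by move=> x; apply: continuous_max => //; apply: cvg_cst. Qed.

Lemma is_derive_sqr_hinge {R : realType} (x : R) :
  is_derive x 1 (fun y => hinge y ^+ 2) (2 * hinge x).
Proof.
case: (ltgtP x 0) => x0.
- apply: (@near_eq_is_derive _ _ _ (cst 0)).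
    near=> y; rewrite /hinge max_r ?expr0n//.
    near: y; exact: lt_le_nbhsl.
  by apply: is_derive_eq; rewrite /hinge max_r ?mulr0 // ltW.
- apply: (@near_eq_is_derive R R^o R^o (fun y : R => y ^+ 2)).
    near=> y; rewrite /hinge max_l//.
    near: y; exact: lt_le_nbhsr.
  apply: is_derive_eq; rewrite /hinge max_l ?(ltW x0)// /GRing.scale /=.
  by ring.
- apply: (proj2 (@is_derive1_caratheodory R (fun y => hinge y ^+ 2) x _));
  exists hinge; split.
  + move=> z; rewrite x0 /hinge maxxx expr0n /= !subr0.
    by case: (leP z 0) => z0; rewrite ?mul0r ?expr0n.
  + exact: continuous_hinge.
  + by rewrite x0 /hinge maxxx mulr0.
Unshelve. all: by end_near. Qed.

(** For [0 < d], a C^1 step: it vanishes up to [a], increases on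
    [[a, a + 2 * d]], and is constant equal to [2 * d ^+ 2] afterwards.  It is the
    second difference, with increment [d], of the square of the positive part. *)
Definition smooth_step {R : realType} (a d x : R) : R :=
  hinge (x - a) ^+ 2 - 2 * hinge (x - (a + d)) ^+ 2
  + hinge (x - (a + 2 * d)) ^+ 2.

(** The derivative of [smooth_step a d]: a tent function of height [2 * d]
    supported on [[a, a + 2 * d]]. *)
Definition hat {R : realType} (a d x : R) : R :=
  2 * (hinge (x - a) - 2 * hinge (x - (a + d)) + hinge (x - (a + 2 * d))).

Lemma is_derive_smooth_step {R : realType} (a d x : R) :
  is_derive x 1 (smooth_step a d) (hat a d x).
Proof.
have H c : is_derive x 1 (fun y => hinge (y - c) ^+ 2) (2 * hinge (x - c)).
  have Hc : is_derive x 1 (fun y => y - c) 1.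
    by apply: is_derive_eq; rewrite subr0.
  have := @is_derive1_comp _ (fun y => hinge y ^+ 2) (fun y => y - c) x _ _
    (is_derive_sqr_hinge (x - c)) Hc.
  by rewrite mulr1.
have := is_deriveD (is_deriveB (H a) (is_deriveZ 2 (H (a + d))))
  (H (a + 2 * d)).
by move=> h; apply: is_derive_eq; rewrite /hat /GRing.scale /=; ring.
Qed.

Lemma continuous_hat {R : realType} (a d : R) : continuous (hat a d).
Proof.
have H c : continuous (fun y : R => hinge (y - c)).
  move=> x; apply: (@continuous_comp R R R (fun y => y - c) hinge);
    last exact: continuous_hinge.
  by apply: cvgB => //; apply: cvg_cst.
move=> x; apply: cvgM; first exact: cvg_cst.
apply: cvgD; last exact: H.
apply: cvgB; first exact: H.
by apply: cvgM; [exact: cvg_cst | exact: H].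
Qed.

Lemma hat_ge0 {R : realType} (a d x : R) :
  0 <= d -> 0 <= hat a d x.
Proof.
move=> d0; rewrite /hat /hinge.
by case: (leP (x - a) 0); case: (leP (x - (a + d)) 0);
  case: (leP (x - (a + 2 * d)) 0); lra.
Qed.

Lemma hat_left {R : realType} (a d x : R) :
  0 <= d -> x <= a -> hat a d x = 0.
Proof.
move=> d0 xa; have xa1 : x - a <= 0 by lra.
have xa2 : x - (a + d) <= 0 by lra.
have xa3 : x - (a + 2 * d) <= 0 by lra.
by rewrite /hat /hinge !max_r//; ring.
Qed.

Lemma hat_right {R : realType} (a d x : R) :
  0 <= d -> a + 2 * d <= x -> hat a d x = 0.
Proof.
move=> d0 xa; have xa1 : 0 <= x - a by lra.
have xa2 : 0 <= x - (a + d) by lra.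
have xa3 : 0 <= x - (a + 2 * d) by lra.
by rewrite /hat /hinge !max_l//; ring.
Qed.

Lemma smooth_step_left {R : realType} (a d x : R) :
  0 <= d -> x <= a -> smooth_step a d x = 0.
Proof.
move=> d0 xa; have xa1 : x - a <= 0 by lra.
have xa2 : x - (a + d) <= 0 by lra.
have xa3 : x - (a + 2 * d) <= 0 by lra.
by rewrite /smooth_step /hinge !max_r//; ring.
Qed.

Lemma smooth_step_right {R : realType} (a d x : R) :
  0 <= d -> a + 2 * d <= x -> smooth_step a d x = 2 * d ^+ 2.
Proof.
move=> d0 xa; have xa1 : 0 <= x - a by lra.
have xa2 : 0 <= x - (a + d) by lra.
have xa3 : 0 <= x - (a + 2 * d) by lra.
by rewrite /smooth_step /hinge !max_l//; ring.
Qed.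

Lemma smooth_step_bounds {R : realType} (a d x : R) :
  0 <= d -> 0 <= smooth_step a d x <= 2 * d ^+ 2.
Proof.
move=> d0; rewrite /smooth_step /hinge.
by case: (leP (x - a) 0); case: (leP (x - (a + d)) 0);
  case: (leP (x - (a + 2 * d)) 0) => *; apply/andP; split; nra.
Qed.

(** * Lebesgue integrals over an interval *)

Section Integration.
Context {R : realType}.
Local Notation mu := (@lebesgue_measure R).

Lemma continuous_integrable_itv (a b : R) (f : R -> R) :
  {within `[a, b], continuous f} -> mu.-integrable `[a, b] (EFin \o f).
Proof.
move=> cf; apply: continuous_compact_integrable => //.
exact: segment_compact.
Qed.

Lemma integrable_mul_continuous (a b : R) (g phi : R -> R) :
  mu.-integrable `[a, b] (EFin \o g) -> continuous phi ->
  mu.-integrable `[a, b] (EFin \o (fun x => g x * phi x)).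
Proof.
move=> ig cphi.
have := @integrableMl _ _ _ mu `[a, b] _ (EFin \o g) phi ig.
apply => //.
- by apply: measurable_funTS; exact: continuous_measurable_fun.
- have cw : {within `[a, b], continuous phi} by exact: continuous_subspaceT.
  have := continuous_compact cw (@segment_compact R a b).
  move=> /compact_bounded[M [_ mrt]].
  by exists M; split; rewrite ?num_real // => ? ? ? ?; exact: mrt.
Qed.

Lemma ae_le_Rintegral (D : set R) (f g : R -> R) : measurable D ->
  mu.-integrable D (EFin \o f) -> mu.-integrable D (EFin \o g) ->
  {ae mu, forall x, D x -> f x <= g x} ->
  \int[mu]_(x in D) f x <= \int[mu]_(x in D) g x.
Proof.
move=> mD if_ ig fg.
have mf : measurable_fun D f by apply/measurable_EFinP; case/integrableP: if_.
have mg : measurable_fun D g by apply/measurable_EFinP; case/integrableP: ig.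
(* [g] agrees almost everywhere with [max f g], which dominates [f]
   everywhere. *)
have -> : \int[mu]_(x in D) g x = \int[mu]_(x in D) Num.max (f x) (g x).
  rewrite /Rintegral; congr fine; apply: ae_eq_integral => //.
  - exact/measurable_EFinP.
  - by apply/measurable_EFinP; exact: measurable_maxr.
  - by apply: negligibleS fg => x /= h fgx; apply: h => Dx; rewrite max_r// fgx.
apply: le_Rintegral => //; last by move=> x _; rewrite le_max lexx.
apply: (@le_integrable _ _ _ mu _ _ _ (fun x => (`|f x| + `|g x|)%:E)) => //.
- by apply/measurable_EFinP; exact: measurable_maxr.
- move=> x _ /=; rewrite lee_fin.
  rewrite [leRHS]ger0_norm ?addr_ge0//.
  by rewrite /Num.max; case: ifP => _; rewrite ?lerDl ?lerDr.
- have := @integrableD _ _ _ mu D mD (EFin \o (Num.norm \o f))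
    (EFin \o (Num.norm \o g)).
  by apply; exact: integrable_norm.
Qed.

(** Essential boundedness suffices because the interval has finite measure. *)
Lemma Linfty_integrable (t0 t1 : R) (f : R -> R) :
  Linfty t0 t1 f -> mu.-integrable `[t0, t1] (EFin \o f).
Proof.
case/andP => /set_mem /= mf /set_mem.
have mI : measurable (`[t0, t1] : set R) by exact: measurable_itv.
have {}mf : measurable_fun `[t0, t1] f by apply/(measurable_restrictT _ mI).
have mu0 : (0 < mu [set: R])%E.
  by rewrite -set_itvNyy lebesgue_measure_itv /= addye ?ltry.
rewrite /finite_norm /= unlock mu0 => fin.
have ae := ess_sup_ge mu (abse \o (EFin \o (f \_ `[t0, t1]))).
apply/integrableP; split; first exact/measurable_EFinP.
set c := ess_sup _ _ in fin ae.
have [M cM] : exists M : R, (c <= M%:E)%E.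
  move: fin; case: c {ae} => [r _| //|_].
    by exists r.
  by exists 0; rewrite leNye.
apply: (@le_lt_trans _ _ (\int[mu]_(x in `[t0, t1]) `|M|%:E)%E).
  apply: ae_ge0_le_integral => //.
    by apply: measurableT_comp => //; exact/measurable_EFinP.
  apply: negligibleS ae => x /= h fx; apply: h => Ix.
  move: (le_trans fx cM); rewrite patchE mem_set// !lee_fin => /le_trans; apply.
  exact: ler_norm.
rewrite integral_cst//; apply: lte_mul_pinfty => //.
have := @lebesgue_measure_itv R `[t0, t1]; rewrite /= => ->.
by case: ifP => _; rewrite ltry.
Qed.
End Integration.

(** * Gronwall's inequality for weak derivatives *)

Section WeakGronwall.
Context {R : realType}.
Local Notation mu := (@lebesgue_measure R).

Lemma Rintegral_derive (a b : R) (phi dphi : R -> R) : a < b ->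
  (forall x : R, is_derive x 1 phi (dphi x)) -> continuous dphi ->
  \int[mu]_(x in `[a, b]) dphi x = phi b - phi a.
Proof.
move=> ab Hd cd; rewrite /Rintegral.
have cphi x : {for x, continuous phi}.
  by apply/differentiable_continuous/derivable1_diffP; case: (Hd x).
rewrite (@continuous_FTC2 _ dphi phi)//.
- exact: continuous_subspaceT.
- split.
  + by move=> x _; case: (Hd x).
  + exact/cvg_at_right_filter/cphi.
  + exact/cvg_at_left_filter/cphi.
- by move=> x _; rewrite derive1E; case: (Hd x).
Qed.

(** The test function [expR (k * x) * psi x], where the plateau [psi] is the
    difference of two steps; for [a + 2 * d <= b] it is nonnegative and
    supported in [[a, b + 2 * d]]. *)
Definition exp_plateau (k a b d x : R) : R :=
  expR (k * x) * (smooth_step a d x - smooth_step b d x).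

Lemma is_derive_exp_plateau (k a b d x : R) :
  is_derive x 1 (exp_plateau k a b d)
  (k * exp_plateau k a b d x + expR (k * x) * (hat a d x - hat b d x)).
Proof.
have He : is_derive x 1 (fun y => expR (k * y)) (expR (k * x) * k).
  apply: (@is_derive1_comp _ expR (fun y => k * y)).
  have := is_deriveZ k (is_derive_id x (1 : R)).
  by rewrite /GRing.scale /= mulr1.
have Hs := is_deriveB (is_derive_smooth_step a d x)
  (is_derive_smooth_step b d x).
have := is_deriveM He Hs.
by move=> h; apply: is_derive_eq;
  rewrite /exp_plateau /GRing.scale /= !fctE; ring.
Qed.

Lemma continuous_exp_plateau (k a b d : R) : continuous (exp_plateau k a b d).
Proof.
move=> x; apply/differentiable_continuous/derivable1_diffP.
by case: (is_derive_exp_plateau k a b d x).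
Qed.

Lemma continuous_expRM (k : R) : continuous (fun x : R => expR (k * x)).
Proof.
move=> x; apply: (@continuous_comp R R R (fun y => k * y) expR);
  last exact: continuous_expR.
by apply: cvgM; [exact: cvg_cst | exact: cvg_id].
Qed.

Lemma continuous_dexp_plateau (k a b d : R) : continuous (fun x =>
  k * exp_plateau k a b d x + expR (k * x) * (hat a d x - hat b d x)).
Proof.
move=> x; apply: cvgD.
  by apply: cvgM; [exact: cvg_cst | exact: continuous_exp_plateau].
apply: cvgM; first exact: continuous_expRM.
by apply: cvgB; exact: continuous_hat.
Qed.

Lemma derive1_exp_plateau (k a b d x : R) : derive1 (exp_plateau k a b d) x =
  k * exp_plateau k a b d x + expR (k * x) * (hat a d x - hat b d x).
Proof. by rewrite derive1E; case: (is_derive_exp_plateau k a b d x). Qed.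

Lemma exp_plateau_ge0 (k a b d x : R) :
  0 < d -> a + 2 * d <= b -> 0 <= exp_plateau k a b d x.
Proof.
move=> d0 ab.
apply: mulr_ge0; first exact: expR_ge0.
have /andP[sa0 sa1] := smooth_step_bounds a d x (ltW d0).
have /andP[sb0 sb1] := smooth_step_bounds b d x (ltW d0).
have [xb|bx] := leP x b.
  by rewrite (smooth_step_left b d x (ltW d0) xb); lra.
have adx : a + 2 * d <= x by lra.
by rewrite (smooth_step_right a d x (ltW d0) adx); lra.
Qed.

Lemma exp_plateau_left (k a b d x : R) :
  0 < d -> a + 2 * d <= b -> x <= a -> exp_plateau k a b d x = 0.
Proof.
move=> d0 ab xa.
have xb : x <= b by lra.
rewrite /exp_plateau (smooth_step_left a d x (ltW d0) xa).
by rewrite (smooth_step_left b d x (ltW d0) xb) subrr mulr0.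
Qed.

Lemma exp_plateau_right (k a b d x : R) :
  0 < d -> a + 2 * d <= b -> b + 2 * d <= x -> exp_plateau k a b d x = 0.
Proof.
move=> d0 ab xa.
have xb : a + 2 * d <= x by lra.
rewrite /exp_plateau (smooth_step_right a d x (ltW d0) xb).
by rewrite (smooth_step_right b d x (ltW d0) xa) subrr mulr0.
Qed.

Lemma test_function_exp_plateau (k a b d t0 t1 : R) :
  0 < d -> a + 2 * d <= b -> t0 < a -> b + 2 * d < t1 ->
  test_function t0 t1 (exp_plateau k a b d).
Proof.
move=> d0 ab t0a bt1.
have sub : closure [set x | exp_plateau k a b d x != 0] `<=` `[a, b + 2 * d].
  have cl : closed (`[a, b + 2 * d] : set R) by exact: interval_closed.
  move/closure_id : cl => ->; apply: closure_subset => x /= nz.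
  rewrite in_itv/=; apply/andP; split; rewrite leNgt; apply/negP => h;
    move/eqP: nz; apply.
    exact: exp_plateau_left (ltW h).
  exact: exp_plateau_right (ltW h).
split.
- by move=> x; case: (is_derive_exp_plateau k a b d x).
- rewrite (funext (derive1_exp_plateau k a b d)).
  exact: continuous_dexp_plateau.
- apply: (subclosed_compact _ (@segment_compact R a (b + 2 * d)) sub).
  exact: closed_closure.
- apply: (subset_trans sub) => x /=; rewrite !in_itv/= => /andP[ax xb].
  by rewrite (lt_le_trans t0a ax) (le_lt_trans xb bt1).
Qed.

(** Throughout this section [f' <= C - k * f] holds weakly on [[t0, t1]]. *)
Section WeakInequality.
Variables (t0 t1 k C : R) (f g : R -> R).
Hypotheses (k0 : 0 < k).
Hypothesis (cf : {within `[t0, t1], continuous f}).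
Hypothesis (ig : mu.-integrable `[t0, t1] (EFin \o g)).
Hypothesis (wfg : weak_derivative t0 t1 f g).
Hypothesis (gle : {ae mu, forall x, `[t0, t1]%classic x -> g x <= C - k * f x}).

(* Formally [F' = (f' + k * f - C) * expR (k * x) <= 0]. *)
Let F x := (f x - C / k) * expR (k * x).

Let cF : {within `[t0, t1], continuous F}.
Proof.
move=> x; apply: cvgM.
  by apply: cvgB; [exact: cf | exact: cvg_cst].
exact: (continuous_subspaceT (continuous_expRM k)).
Qed.

(** The weak form of [F' <= 0], tested against the plateau. *)
Lemma Rintegral_hat_diff_ge0 (a b d : R) : 0 < d -> t0 < a -> a + 2 * d <= b ->
  b + 2 * d < t1 ->
  0 <= \int[mu]_(x in `[t0, t1]) (F x * (hat a d x - hat b d x)).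
Proof.
move=> d0 t0a ab bt1.
have mI : measurable (`[t0, t1] : set R) by exact: measurable_itv.
have t01 : t0 < t1 by lra.
have iM (u v : R -> R) : {within `[t0, t1], continuous u} -> continuous v ->
    mu.-integrable `[t0, t1] (EFin \o (fun x => u x * v x)).
  by move=> cu cv; apply: integrable_mul_continuous => //;
    exact: continuous_integrable_itv.
have cphi := continuous_exp_plateau k a b d.
have cdphi := continuous_dexp_plateau k a b d.
set phi := exp_plateau k a b d in cphi cdphi *.
set dphi := (fun x => _) in cdphi.
have ch : continuous (fun x => hat a d x - hat b d x).
  by move=> x; apply: cvgB; exact: continuous_hat.
have w : \int[mu]_(x in `[t0, t1]) (f x * dphi x) =
    - \int[mu]_(x in `[t0, t1]) (g x * phi x).
  rewrite -(wfg _ (test_function_exp_plateau k a b d t0 t1 d0 ab t0a bt1)).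
  by apply: eq_Rintegral => x _; rewrite derive1_exp_plateau.
have i0 : \int[mu]_(x in `[t0, t1]) dphi x = 0.
  rewrite (Rintegral_derive t0 t1 phi dphi t01
    (is_derive_exp_plateau k a b d) cdphi).
  by rewrite /phi exp_plateau_right ?exp_plateau_left ?subrr// ltW.
have cCf : {within `[t0, t1], continuous (fun x => C - k * f x)}.
  move=> x; apply: cvgB; first exact: cvg_cst.
  by apply: cvgM; [exact: cvg_cst | exact: cf].
have le1 : \int[mu]_(x in `[t0, t1]) (g x * phi x) <=
    \int[mu]_(x in `[t0, t1]) ((C - k * f x) * phi x).
  apply: ae_le_Rintegral => //; first exact: integrable_mul_continuous.
    exact: iM.
  apply: negligibleS gle => x /= h fx; apply: h => Ix.
  by apply: ler_wpM2r; [exact: exp_plateau_ge0 | exact: fx].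
have e1 : \int[mu]_(x in `[t0, t1]) (f x * dphi x + (C - k * f x) * phi x) =
  \int[mu]_(x in `[t0, t1]) (f x * dphi x) +
  \int[mu]_(x in `[t0, t1]) ((C - k * f x) * phi x).
  by rewrite RintegralD//; exact: iM.
(* The terms in [k * f * phi] cancel, and [C * phi] is rewritten with the
   derivative of [phi], whose integral is zero. *)
have e2 : \int[mu]_(x in `[t0, t1]) (f x * dphi x + (C - k * f x) * phi x) =
  \int[mu]_(x in `[t0, t1]) (F x * (hat a d x - hat b d x)) +
  (C / k) * \int[mu]_(x in `[t0, t1]) dphi x.
  rewrite -RintegralZl//; last first.
    by apply: continuous_integrable_itv; exact: continuous_subspaceT.
  rewrite -RintegralD//; last 2 first.
  - exact: iM.
  - by apply: iM => //; move=> x; exact: cvg_cst.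
  apply: eq_Rintegral => x _; rewrite /F /dphi /phi /exp_plateau; field.
  by rewrite gt_eqF.
by rewrite i0 mulr0 addr0 in e2; rewrite -e2 e1 w; lra.
Qed.

(** Both hats have integral [2 * d ^+ 2], so bounds of [F] on their supports
    can be compared. *)
Lemma hat_comparison (a b d c1 c2 : R) : 0 < d -> t0 < a -> a + 2 * d <= b ->
  b + 2 * d < t1 ->
  (forall x, a <= x <= a + 2 * d -> F x <= c1) ->
  (forall x, b <= x <= b + 2 * d -> c2 <= F x) -> c2 <= c1.
Proof.
move=> d0 t0a ab bt1 Fa Fb.
have t01 : t0 < t1 by lra.
have ihat (c : R) : t0 < c -> c + 2 * d < t1 ->
    \int[mu]_(x in `[t0, t1]) hat c d x = 2 * d ^+ 2.
  move=> t0c ct1.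
  rewrite (Rintegral_derive t0 t1 (smooth_step c d) (hat c d) t01
    (is_derive_smooth_step c d) (continuous_hat c d)).
  by rewrite smooth_step_right ?smooth_step_left ?subr0// ltW.
have inthat (c : R) : mu.-integrable `[t0, t1] (EFin \o hat c d).
  apply: continuous_integrable_itv; apply: continuous_subspaceT.
  exact: continuous_hat.
have intZ (c e : R) :
    mu.-integrable `[t0, t1] (EFin \o (fun x => e * hat c d x)).
  apply: continuous_integrable_itv; apply: continuous_subspaceT => x.
  by apply: cvgM; [exact: cvg_cst | exact: continuous_hat].
have := Rintegral_hat_diff_ge0 a b d d0 t0a ab bt1.
have : \int[mu]_(x in `[t0, t1]) (F x * (hat a d x - hat b d x)) <=
       \int[mu]_(x in `[t0, t1]) (c1 * hat a d x - c2 * hat b d x).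
  apply: le_Rintegral => //.
  - apply: integrable_mul_continuous.
      exact: continuous_integrable_itv.
    by move=> x; apply: cvgB; exact: continuous_hat.
  - apply: continuous_integrable_itv; apply: continuous_subspaceT => x.
    apply: cvgB; (apply: cvgM; [exact: cvg_cst | exact: continuous_hat]).
  move=> x _; rewrite mulrBr; apply: lerB.
    have [xa|ax] := leP x a; first by rewrite hat_left ?mulr0// ltW.
    have [ax2|xa2] := leP (a + 2 * d) x.
      by rewrite hat_right ?mulr0// ltW.
    by apply: ler_wpM2r; [exact/hat_ge0/ltW | apply: Fa; rewrite !ltW].
  have [xa|ax] := leP x b; first by rewrite hat_left ?mulr0// ltW.
  have [ax2|xa2] := leP (b + 2 * d) x; first by rewrite hat_right ?mulr0// ltW.
  by apply: ler_wpM2r; [exact/hat_ge0/ltW | apply: Fb; rewrite !ltW].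
have ihatZ (c e : R) : t0 < c -> c + 2 * d < t1 ->
    \int[mu]_(x in `[t0, t1]) (e * hat c d x) = e * (2 * d ^+ 2).
  by move=> t0c ct1; rewrite -(ihat c t0c ct1) -RintegralZl.
have ad1 : a + 2 * d < t1 by lra.
have t0b : t0 < b by lra.
rewrite RintegralB// (ihatZ a c1 t0a ad1) (ihatZ b c2 t0b bt1) => h1 h2.
have h3 := le_trans h2 h1.
have d2 : 0 < 2 * d ^+ 2 by rewrite mulr_gt0 ?exprn_gt0.
by move: h3; rewrite -mulrBl pmulr_lge0// subr_ge0.
Qed.

(** Gronwall's inequality for a weak derivative: [F t <= F t0]. *)
Lemma weak_gronwall (t : R) : t0 <= t <= t1 ->
  (f t - C / k) * expR (k * t) <= (f t0 - C / k) * expR (k * t0).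
Proof.
case/andP; rewrite le_eqVlt => /predU1P[<-//|t0t] tt1.
rewrite -/(F t) -/(F t0) leNgt; apply/negP => FF.
pose e := (F t - F t0) / 3.
have e0 : 0 < e by rewrite /e; lra.
have cFt : {within `[t0, t], continuous F}.
  by apply: continuous_subspaceW cF; apply: subset_itvl; rewrite bnd_simp.
have [_ /cvgrPdist_lt/(_ _ e0) Fl /cvgrPdist_lt/(_ _ e0) Fr] :=
  (continuous_within_itvP _ t0t).1 cFt.
case: Fl => r1 /= r10 Fl; case: Fr => r2 /= r20 Fr.
(* The hats live on [[t0 + d, t0 + 3 * d]] and [[t - 3 * d, t - d]]; as
   [8 * d <= t - t0], they are disjoint and inside the interval. *)
pose d := Num.min (Num.min r1 r2) (t - t0) / 8.
have m0 : 0 < Num.min (Num.min r1 r2) (t - t0).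
  by rewrite !lt_min r10 r20 /= subr_gt0.
have m1 : Num.min (Num.min r1 r2) (t - t0) <= r1 by rewrite !ge_min lexx.
have m2 : Num.min (Num.min r1 r2) (t - t0) <= r2 by rewrite !ge_min lexx !orbT.
have m3 : Num.min (Num.min r1 r2) (t - t0) <= t - t0.
  by rewrite !ge_min lexx !orbT.
have d0 : 0 < d by rewrite /d; lra.
have d1 : 8 * d <= r1 by rewrite /d; lra.
have d2 : 8 * d <= r2 by rewrite /d; lra.
have d3 : 8 * d <= t - t0 by rewrite /d; lra.
suff : F t - e <= F t0 + e by move: FF; rewrite /e; lra.
apply: (@hat_comparison (t0 + d) (t - 3 * d) d); [lra..| |].
- move=> x /andP[xl xr].
  have : `|F t0 - F x| < e.
    apply: Fl; last by lra.
    by rewrite /= ltr0_norm; lra.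
  by rewrite ltr_distlC => /andP[_ /ltW]; lra.
- move=> x /andP[xl xr].
  have : `|F t - F x| < e.
    apply: Fr; last by lra.
    by rewrite /= gtr0_norm; lra.
  by rewrite ltr_distlC => /andP[/ltW]; lra.
Qed.
End WeakInequality.
End WeakGronwall.

(** * Linear combinations of weakly differentiable functions *)

Section WeaklyDifferentiable.
Context {R : realType}.
Local Notation mu := (@lebesgue_measure R).

(** [f] is continuous on [[t0, t1]] and has the integrable weak derivative [g].
    Unlike membership in a space W^{1,oo}, this is stated for one coordinate and
    is stable under linear combinations. *)
Definition weak_pair (t0 t1 : R) (f g : R -> R) : Prop :=
  [/\ {within `[t0, t1], continuous f}, mu.-integrable `[t0, t1] (EFin \o g) &
      weak_derivative t0 t1 f g].

Lemma test_function_continuous (t0 t1 : R) (phi : R -> R) :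
  test_function t0 t1 phi -> continuous phi.
Proof.
by case=> dphi _ _ _ x; apply/differentiable_continuous/derivable1_diffP.
Qed.

Lemma weak_pair0 (t0 t1 : R) : weak_pair t0 t1 (fun=> 0) (fun=> 0).
Proof.
have c0 : {within `[t0, t1], continuous (fun=> 0 : R)}.
  by move=> x; exact: cvg_cst.
split => //; first exact: continuous_integrable_itv.
move=> phi _.
have z (h : R -> R) : \int[mu]_(x in `[t0, t1]) (0 * h x) = 0.
  under eq_Rintegral do rewrite mul0r.
  by rewrite Rintegral_cst// mul0r.
by rewrite !z oppr0.
Qed.

Lemma weak_pair_linear (t0 t1 c : R) (f1 g1 f2 g2 : R -> R) :
  weak_pair t0 t1 f1 g1 -> weak_pair t0 t1 f2 g2 ->
  weak_pair t0 t1 (fun x => c * f1 x + f2 x) (fun x => c * g1 x + g2 x).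
Proof.
move=> [cf1 ig1 w1] [cf2 ig2 w2].
have mI : measurable (`[t0, t1] : set R) by exact: measurable_itv.
have Z (u : R -> R) : mu.-integrable `[t0, t1] (EFin \o u) ->
    mu.-integrable `[t0, t1] (EFin \o (fun x => c * u x)).
  by move=> iu; have := @integrableZl _ _ _ mu _ mI c _ iu.
have lin (u v phi : R -> R) : mu.-integrable `[t0, t1] (EFin \o u) ->
    mu.-integrable `[t0, t1] (EFin \o v) -> continuous phi ->
    \int[mu]_(x in `[t0, t1]) ((c * u x + v x) * phi x) =
    c * \int[mu]_(x in `[t0, t1]) (u x * phi x) +
    \int[mu]_(x in `[t0, t1]) (v x * phi x).
  move=> iu iv cphi.
  rewrite -RintegralZl//; last exact: integrable_mul_continuous.
  rewrite -RintegralD//; last 2 first.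
  - by apply: Z; exact: integrable_mul_continuous.
  - exact: integrable_mul_continuous.
  by apply: eq_Rintegral => x _; ring.
split.
- move=> x; apply: cvgD; last exact: cf2.
  by apply: cvgM; [exact: cvg_cst | exact: cf1].
- by have := @integrableD _ _ _ mu _ mI _ _ (Z _ ig1) ig2.
- move=> phi tphi; have cphi := test_function_continuous _ _ _ tphi.
  have cdphi : continuous (derive1 phi) by case: tphi.
  rewrite !lin//; try exact: continuous_integrable_itv.
  by rewrite w1// w2//; ring.
Qed.

Lemma weak_pair_sum (t0 t1 : R) (I : Type) (s : seq I) (c : I -> R)
    (f g : I -> R -> R) : (forall i, weak_pair t0 t1 (f i) (g i)) ->
  weak_pair t0 t1 (fun x => \sum_(i <- s) c i * f i x)
    (fun x => \sum_(i <- s) c i * g i x).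
Proof.
move=> H; elim: s => [|i s IH].
  have -> : (fun x => \sum_(i <- [::]) c i * f i x) = (fun=> 0).
    by apply/funext => x; rewrite big_nil.
  have -> : (fun x => \sum_(i <- [::]) c i * g i x) = (fun=> 0).
    by apply/funext => x; rewrite big_nil.
  exact: weak_pair0.
have -> : (fun x => \sum_(i <- i :: s) c i * f i x) =
    (fun x => c i * f i x + \sum_(i <- s) c i * f i x).
  by apply/funext => x; rewrite big_cons.
have -> : (fun x => \sum_(i <- i :: s) c i * g i x) =
    (fun x => c i * g i x + \sum_(i <- s) c i * g i x).
  by apply/funext => x; rewrite big_cons.
exact: weak_pair_linear.
Qed.

Lemma W1infty_weak_pair (n : nat) (P : set 'rV[R]_n) (t0 t1 : R)
    (theta dtheta : R -> 'rV[R]_n) (i : 'I_n) :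
  W1infty t0 t1 P theta dtheta ->
  weak_pair t0 t1 (fun t => theta t 0 i) (fun t => dtheta t 0 i).
Proof.
move=> [cth _ /(_ i)[_ Ldth w]]; split => //; last exact: Linfty_integrable.
move=> x; have := cth x; rewrite /continuous_at => h.
apply: (cvg_comp _ (fun v : 'rV[R]_n => v 0 i) h).
exact: coord_continuous.
Qed.

End WeaklyDifferentiable.

(** * Euclidean geometry *)

Section Euclidean.
Context {R : realType}.

(** The Euclidean inner product. *)
Definition dotv {n : nat} (x y : 'rV[R]_n) : R := \sum_(i < n) x 0 i * y 0 i.

Lemma enorm_ge0 (n : nat) (x : 'rV[R]_n) : 0 <= enorm x.
Proof. exact: sqrtr_ge0. Qed.

Lemma sqr_enorm (n : nat) (x : 'rV[R]_n) : enorm x ^+ 2 = dotv x x.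
Proof.
rewrite sqr_sqrtr; last by apply: sumr_ge0 => i _; exact: sqr_ge0.
by apply: eq_bigr => i _; rewrite expr2.
Qed.

Lemma enorm0_eq0 (n : nat) (x : 'rV[R]_n) : enorm x = 0 -> x = 0.
Proof.
move=> x0; apply/rowP => i; rewrite mxE; apply/eqP; rewrite -sqrf_eq0.
have /eqP : \sum_(j < n) x 0 j ^+ 2 = 0.
  transitivity (dotv x x); first by apply: eq_bigr => j _; rewrite expr2.
  by rewrite -sqr_enorm x0 expr0n.
rewrite psumr_eq0; last by move=> j _; exact: sqr_ge0.
by move/allP/(_ i (mem_index_enum i)).
Qed.

(** Cauchy-Schwarz. *)
Lemma dotv_le (n : nat) (x y : 'rV[R]_n) : dotv x y <= enorm x * enorm y.
Proof.
have [->|x0] := eqVneq x 0.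
  rewrite /dotv big1 ?mulr_ge0 ?enorm_ge0// => i _.
  by rewrite mxE mul0r.
have [->|y0] := eqVneq y 0.
  rewrite /dotv big1 ?mulr_ge0 ?enorm_ge0// => i _.
  by rewrite mxE mulr0.
have pos (z : 'rV[R]_n) : z != 0 -> 0 < enorm z.
  move=> z0; rewrite lt0r enorm_ge0 andbT.
  by apply: contra z0 => /eqP/enorm0_eq0->.
(* Expanding [enorm (enorm y *: x - enorm x *: y) ^+ 2 >= 0]. *)
have h : 0 <= \sum_(i < n) (enorm y * x 0 i - enorm x * y 0 i) ^+ 2.
  by apply: sumr_ge0 => i _; exact: sqr_ge0.
have e : \sum_(i < n) (enorm y * x 0 i - enorm x * y 0 i) ^+ 2 =
   enorm y ^+ 2 * dotv x x - 2 * (enorm x * enorm y) * dotv x y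
   + enorm x ^+ 2 * dotv y y.
  rewrite /dotv !mulr_sumr -sumrB -big_split/=.
  by apply: eq_bigr => i _; ring.
rewrite e -!sqr_enorm in h.
have p : 0 < enorm x * enorm y by rewrite mulr_gt0 ?pos.
by rewrite -subr_ge0 -(pmulr_rge0 _ p); nra.
Qed.

Lemma enormN (n : nat) (x : 'rV[R]_n) : enorm (- x) = enorm x.
Proof.
by rewrite /enorm; congr Num.sqrt; apply: eq_bigr => i _; rewrite mxE sqrrN.
Qed.

End Euclidean.

(** * Tracking a moving target *)

Section Tracking.
Context {R : realType}.
Local Notation mu := (@lebesgue_measure R).

(** A statement independent of [t] that holds for almost every [t] in a
    nondegenerate interval is true. *)
Lemma ae_itv_cst (t0 t1 : R) (Q : Prop) : t0 < t1 ->
  {ae mu, forall t, t0 <= t <= t1 -> Q} -> Q.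
Proof.
move=> t01 [N [mN muN sub]]; apply: contrapT => nQ.
have : (mu `[t0, t1] <= mu N)%E.
  apply: le_measure; rewrite ?inE//.
  move=> x /= xI; apply: sub => /= h; apply: nQ; apply: h.
  by move: xI; rewrite in_itv.
rewrite muN lebesgue_measure_itv /= lte_fin t01 -EFinD lee_fin.
by rewrite leNgt subr_gt0 t01.
Qed.

(** A solution of [theta' = kappa (theta_star - theta)] stays within its initial
    distance plus [V / kappa] of a target moving with speed at most [V]. *)
Lemma tracking_bound (n : nat) (P : set 'rV[R]_n) (t0 t1 kappa V : R)
    (theta_star dtheta_star theta dtheta : R -> 'rV[R]_n) :
  t0 < t1 -> 0 < kappa ->
  W1infty t0 t1 P theta_star dtheta_star ->
  W1infty t0 t1 P theta dtheta ->
  {ae mu, forall t, t0 <= t <= t1 ->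
     dtheta t = kappa *: (theta_star t - theta t)} ->
  {ae mu, forall t, t0 <= t <= t1 -> enorm (dtheta_star t) <= V} ->
  forall t, t0 <= t <= t1 ->
  enorm (theta t - theta_star t) <=
  enorm (theta t0 - theta_star t0) + V / kappa.
Proof.
move=> t01 k0 Ws We ode bd t tI.
(* The bound on [dtheta_star] forces [V >= 0], the interval not being null. *)
have V0 : 0 <= V.
  apply: (@ae_itv_cst t0 t1) => //.
  apply: negligibleS bd => x /= h bx; apply: h => xI.
  exact: le_trans (enorm_ge0 _ _) (bx xI).
set v := theta t - theta_star t.
have [v0|v0] := eqVneq (enorm v) 0.
  by rewrite v0 addr_ge0 ?enorm_ge0// divr_ge0// ltW.
pose f x := \sum_(i < n) v 0 i * (-1 * theta_star x 0 i + theta x 0 i).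
pose g x := \sum_(i < n) v 0 i * (-1 * dtheta_star x 0 i + dtheta x 0 i).
have fE x : f x = dotv v (theta x - theta_star x).
  by apply: eq_bigr => i _; congr (_ * _); rewrite !mxE mulN1r addrC.
have [cf ig wfg] : weak_pair t0 t1 f g.
  apply: (weak_pair_sum t0 t1 _ _ (fun i => v 0 i)
    (fun i x => -1 * theta_star x 0 i + theta x 0 i)
    (fun i x => -1 * dtheta_star x 0 i + dtheta x 0 i)) => i.
  apply: weak_pair_linear; exact: (W1infty_weak_pair n P).
have gle : {ae mu, forall x, `[t0, t1]%classic x ->
    g x <= enorm v * V - kappa * f x}.
  apply: negligibleS (negligibleU ode bd) => x /= h; apply/not_andP => -[h1 h2].
  apply: h; rewrite in_itv/= => xI.
  have -> : g x = dotv (- v) (dtheta_star x) - kappa * f x.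
    rewrite /g /f /dotv mulr_sumr -sumrB; apply: eq_bigr => i _.
    by rewrite h1// !mxE; ring.
  rewrite lerD2r; apply: (le_trans (dotv_le _ _ _)); rewrite enormN.
  by apply: ler_wpM2l; [exact: enorm_ge0 | exact: h2].
have := weak_gronwall t0 t1 kappa (enorm v * V) f g k0 cf ig wfg gle t tI.
have ft : f t = enorm v * enorm v by rewrite fE -/v -sqr_enorm expr2.
have ft0 : f t0 <= enorm v * enorm (theta t0 - theta_star t0).
  by rewrite fE; exact: dotv_le.
set N := enorm v in v0 ft ft0 *.
set e0 := enorm _ in ft0 *.
have N0 : 0 < N by rewrite lt0r v0 enorm_ge0.
have e00 : 0 <= e0 by exact: enorm_ge0.
have W0 : 0 <= V / kappa by rewrite divr_ge0// ltW.
(* It remains to read off [N <= e0 + V / kappa] from the Gronwall inequality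
   [N * (N - V / kappa) * expR (kappa * t)
    <= (f t0 - N * (V / kappa)) * expR (kappa * t0)]. *)
have E0 := expR_gt0 (kappa * t0).
have E1 : expR (kappa * t0) <= expR (kappa * t).
  by rewrite ler_expR ler_pM2l//; case/andP: tI.
rewrite ft -(mulrA N V) -mulrBr => G.
have {}G : (N - V / kappa) * expR (kappa * t) <=
    (e0 - V / kappa) * expR (kappa * t0).
  rewrite -(ler_pM2l N0) mulrA; apply: (le_trans G).
  by rewrite [leRHS]mulrA; apply: ler_wpM2r; [exact: ltW | rewrite mulrBr lerB].
rewrite leNgt; apply/negP => lt.
have h1 : e0 * expR (kappa * t0) <= e0 * expR (kappa * t) by exact: ler_wpM2l.
have h2 : e0 * expR (kappa * t) < (N - V / kappa) * expR (kappa * t).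
  by rewrite ltr_pM2r; [lra | exact: expR_gt0].
have h3 : 0 <= V / kappa * expR (kappa * t0) by rewrite mulr_ge0// ltW.
by move: G; rewrite mulrBl; lra.
Qed.
End Tracking.

(** * The delay window *)

Theorem theorem5p3 (R : realType) (P : set 'rV[R]_10) (hP : parameter_set P)
  (LR : R) (hLR : 0 < LR)
  (hLip : forall x y, P x -> P y -> `|RLA x - RLA y| <= LR * enorm (x - y))
  (t0 t1 : R) (ht01 : t0 < t1)
  (theta_star dtheta_star theta dtheta : R -> 'rV[R]_10)
  (h_star : W1infty t0 t1 P theta_star dtheta_star)
  (h_eff : W1infty t0 t1 P theta dtheta)
  (kappa : R) (hkappa : 0 < kappa)
  (h_ode : \forall t \ae (@lebesgue_measure R), t0 <= t <= t1 ->
     dtheta t = kappa *: (theta_star t - theta t))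
  (r_star r_eff : R -> R)
  (hr_star : forall t, r_star t = RLA (theta_star t))
  (hr_eff : forall t, r_eff t = RLA (theta t))
  (sigma : R) (hsigma : sigma = 1 \/ sigma = -1)
  (t_star : R)
  (hD1 : unique (fun s => [/\ t0 < s < t1,
            forall t, t0 <= t < s -> sigma * (r_star t - 1) < 0 &
            r_star s = 1]) t_star)
  (m_star Delta_star : R) (hm : 0 < m_star) (hDelta : 0 < Delta_star)
  (hDelta_t1 : t_star + Delta_star <= t1)
  (hD2 : forall t, t_star <= t <= t_star + Delta_star ->
     m_star * (t - t_star) <= sigma * (r_star t - 1))
  (hD3 : forall t, t0 <= t <= t1 ->
     sigma * (r_eff t - 1) <= sigma * (r_star t - 1))
  (V_star : R)
  (hD4 : \forall t \ae (@lebesgue_measure R), t0 <= t <= t1 ->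
     enorm (dtheta_star t) <= V_star)
  (E_star : R)
  (hE : E_star = enorm (theta t0 - theta_star t0) + V_star / kappa)
  (hwindow : LR * E_star / m_star <= Delta_star) :
  [/\ has_inf (crossing_set t0 t1 sigma r_eff),
      0 <= crossing_time t0 t1 sigma r_eff - t_star <= LR * E_star / m_star,
      forall t, t0 <= t < t_star -> sigma * (r_eff t - 1) < 0 &
      exists2 t, t_star <= t <= t_star + LR * E_star / m_star &
        t0 <= t <= t1 /\ 0 <= sigma * (r_eff t - 1)].
Proof.
have [[/andP[t0s st1] before _] _] := hD1.
have bd := tracking_bound 10 P t0 t1 kappa V_star theta_star dtheta_star theta
  dtheta ht01 hkappa h_star h_eff h_ode hD4.
have [_ Ps _] := h_star; have [_ Pe _] := h_eff.
set w := LR * E_star / m_star in hwindow *.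
pose t' := t_star + w.
have E0 : 0 <= E_star.
  rewrite hE; apply: le_trans (bd t0 _); first exact: enorm_ge0.
  by rewrite lexx ltW.
have w0 : 0 <= w by rewrite divr_ge0 ?mulr_ge0// ltW.
have t'I : t0 <= t' <= t1 by rewrite /t'; lra.
have t'D : t_star <= t' <= t_star + Delta_star by rewrite /t'; lra.
have cross : 0 <= sigma * (r_eff t' - 1).
  have := hD2 _ t'D; rewrite /t' addrAC subrr add0r -/t' => h2.
  have mw : m_star * w = LR * E_star by rewrite /w mulrC divfK// gt_eqF.
  have : `|r_star t' - r_eff t'| <= LR * E_star.
    rewrite hr_star hr_eff distrC.
    apply: le_trans (hLip _ _ (Pe _ _) (Ps _ _)) _; rewrite ?in_itv//.
    by apply: ler_wpM2l; [exact: ltW | rewrite hE; exact: bd].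
  rewrite mw in h2; rewrite ler_norml => /andP[ha hb].
  by case: hsigma h2 => ->; lra.
have early t : t0 <= t < t_star -> sigma * (r_eff t - 1) < 0.
  move=> /[dup] tI /before; apply: le_lt_trans; apply: hD3.
  by case/andP: tI => -> /ltW/le_trans; apply; exact: ltW.
have lb : lbound (crossing_set t0 t1 sigma r_eff) t_star.
  move=> t [/andP[t0t _] ct]; rewrite leNgt; apply/negP => ts.
  by have := early t; rewrite t0t ts ltNge ct => /(_ isT).
have mem : crossing_set t0 t1 sigma r_eff t' by split.
have hi : has_inf (crossing_set t0 t1 sigma r_eff).
  by split; [exists t' | exists t_star].
split => //.
- rewrite subr_ge0 lerBlDl; apply/andP; split.
    by apply: lb_le_inf => //; exists t'.
  by apply: ge_inf => //; exists t_star.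
- by exists t'; [rewrite /t' lerDl w0 lexx | split].
Qed.
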